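(* Suppose the parallel server system satisfies the relaxed heavy traffic condition and the relaxed complete resource pooling condition, let $(v,u)$ be the unique optimal dual LP solution and let $d_{ik}=u_k-\mu_{ik}v_i$. Under the WWTA policy and a non-idling scheduling policy $\mathcal{P}$, for each $r\in(0,1)$, $$\sum_{k=1}^K u_k\,\mathbb{P}\Big(\sum_{i\in\mathcal{I}(k)}Z^{(r)}_{ik}=0\Big)+\sum_{k=1}^K\sum_{i\in\mathcal{I}(k)}d_{ik}\,\mathbb{E}\big[P_{ik}(Z^{(r)})\big]=r,$$ and, for every activity $(i,k)\in\mathcal{J}$, $$\lambda_i^{(r)}\,\mathbb{P}\big(k=L^{(i)}(Z^{(r)})\big)=\mu_{ik}\,\mathbb{E}\big[P_{ik}(Z^{(r)})\big].$$
   Context: Model. Job classes $\mathcal{I}=\{1,\ldots,I\}$, servers $\mathcal{K}=\{1,\ldots,K\}$, and a set $\mathcal{J}\subset\mathcal{I}\times\mathcal{K}$ of $J$ activities ($(i,k)\in\mathcal{J}$ means server $k$ can process class $i$). $\mathcal{I}(k)=\{i:(i,k)\in\mathcal{J}\}$, $\mathcal{K}(i)=\{k:(i,k)\in\mathcal{J}\}$. Class $i$ has nominal arrival rate $\lambda_i>0$ (Poisson arrivals); service times for activity $(i,k)$ are exponential with mean $m_{ik}=1/\mu_{ik}$, $\mu_{ik}>0$. LP (static allocation problem): minimize $\rho$ over $x=(x_{ik})_{(i,k)\in\mathcal{J}}\ge 0$, $\rho\ge0$, subject to $\sum_{k\in\mathcal{K}(i)}\mu_{ik}x_{ik}=\lambda_i$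 for all $i$, and $\sum_{i\in\mathcal{I}(k)}x_{ik}\le\rho$ for all $k$. Dual LP: maximize $\sum_i\lambda_iv_i$ over $v\in\mathbb{R}^I$, $u\in\mathbb{R}^K$, $u\ge0$, subject to $\mu_{ik}v_i\le u_k$ for all $(i,k)\in\mathcal{J}$ and $\sum_ku_k\le1$. Relaxed heavy traffic condition: the LP has an optimal solution $(x^*,\rho^* )$ (not necessarily unique) with $\rho^*=1$ and $\sum_{i\in\mathcal{I}(k)}x^*_{ik}=1$ for every $k$. Activity $(i,k)$ is basic associated with such an $x^*$ if $x^*_{ik}>0$. Servers $k,k'$ communicate directly if for some such $x^*$ and some class $i$ both $(i,k)$ and $(i,k')$ are basic activities associated with $x^*$; servers $k,k'$ communicate if there is a sequence $k=k_1,\ldots,k_\omega=k'$ with consecutive servers communicating directly. Relaxed complete resource pooling condition: such an $x^*$ exists and all servers communicate (different links may use different optimal $x^*$). Under these two conditions the dual LP has a unique optimal solution $(v,u)$, with all $u_k>0$, $v_i>0$. Policies. A state is $z=(z_{ik})_{(i,k)\in\mathcal{J}}\in\mathbb{Z}_+^J$, $z_{ik}$ being the number of jobs in buffer $(i,k)$ (including in service). Workload: $W_k(z)=\sum_{i\in\mathcal{I}(k)}m_{ik}z_{ik}$. WWTA routing: a class $i$ arrival in state $z$ is immediately routed to server $L^{(i)}(z)$, the smallest index in $\arg\min_{k\in\mathcal{K}(i)}m_{ik}W_k(z)$. A non-idling scheduling policy $\mathcal{P}=(P_{ik}(z))$ gives the fraction $P_{ik}(z)\in[0,1]$ of effort of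 server $k$ devoted to class $i$ in state $z$, with $P_{ik}(z)=0$ if $z_{ik}=0$ and $\sum_{i\in\mathcal{I}(k)}P_{ik}(z)=1$ whenever $\sum_{i\in\mathcal{I}(k)}z_{ik}>0$. Sequence of systems. For $r\in(0,1)$, the $r$th system has arrival rates $\lambda_i^{(r)}=\lambda_i(1-r)$, other parameters unchanged. Its queue length process is the continuous-time Markov chain on $\mathbb{Z}_+^J$ with generator $$Gf(z)=\sum_{i}\lambda_i^{(r)}\sum_{k\in\mathcal{K}(i)}[f(z+e_{ik})-f(z)]\mathbf{1}(k=L^{(i)}(z))+\sum_k\sum_{i\in\mathcal{I}(k)}\mu_{ik}P_{ik}(z)[f(z-e_{ik})-f(z)],$$ $e_{ik}$ the unit vectors. For each $r\in(0,1)$ it has a unique stationary distribution; $Z^{(r)}$ denotes a random vector with this distribution. *)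

(* Defs.v *)
From HB Require Import structures.
From mathcomp Require Import all_boot all_order all_algebra.
From mathcomp Require Import all_classical all_reals all_analysis.

Set Implicit Arguments.
Unset Strict Implicit.
Unset Printing Implicit Defensive.

Import Order.TTheory GRing.Theory Num.Theory.
Import numFieldNormedType.Exports.

Local Open Scope classical_set_scope.
Local Open Scope ring_scope.

(** * Parallel server systems *)

(* Classes and servers are numbered from 0. *)
Record pss (R : realType) := Pss {
  nclass : nat;
  nserver : nat;
  act_set : {set 'I_nclass * 'I_nserver};
  lambda : 'I_nclass -> R;
  mu : {a : 'I_nclass * 'I_nserver | a \in act_set} -> R;
  lambda_gt0 : forall i, 0 < lambda i;
  mu_gt0 : forall a, 0 < mu a }.

(* An activity a stands for the pair (cls a, srv a) in the activity set, so a
   sum over I(k) is a sum over the a with srv a == k, and a sum over K(i) is a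
   sum over the a with cls a == i. *)
Definition activity (R : realType) (s : pss R) : Type :=
  {a : 'I_(nclass s) * 'I_(nserver s) | a \in act_set s}.

HB.instance Definition _ (R : realType) (s : pss R) :=
  Finite.copy (activity s)
    {a : 'I_(nclass s) * 'I_(nserver s) | a \in act_set s}.

Definition cls (R : realType) (s : pss R) (a : activity s) : 'I_(nclass s) :=
  (sval a).1.

Definition srv (R : realType) (s : pss R) (a : activity s) : 'I_(nserver s) :=
  (sval a).2.

Definition mean_service (R : realType) (s : pss R) (a : activity s) : R :=
  (mu a)^-1.

(** * The static allocation problem and its dual *)

Definition server_load (R : realType) (s : pss R) (x : activity s -> R)
    (k : 'I_(nserver s)) : R :=
  \sum_(a : activity s | srv a == k) x a.

Definition primal_feasible (R : realType) (s : pss R)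
    (x : activity s -> R) (rho : R) : Prop :=
  [/\ forall a, 0 <= x a,
      0 <= rho,
      forall i, \sum_(a : activity s | cls a == i) mu a * x a = lambda i
    & forall k, server_load x k <= rho].

Definition primal_optimal (R : realType) (s : pss R)
    (x : activity s -> R) (rho : R) : Prop :=
  primal_feasible x rho /\
  forall x' rho', primal_feasible (s := s) x' rho' -> rho <= rho'.

Definition dual_feasible (R : realType) (s : pss R)
    (v : 'I_(nclass s) -> R) (u : 'I_(nserver s) -> R) : Prop :=
  [/\ forall k, 0 <= u k,
      forall a : activity s, mu a * v (cls a) <= u (srv a)
    & \sum_k u k <= 1].

Definition dual_optimal (R : realType) (s : pss R)
    (v : 'I_(nclass s) -> R) (u : 'I_(nserver s) -> R) : Prop :=
  dual_feasible v u /\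
  forall v' u', dual_feasible (s := s) v' u' ->
    \sum_i lambda i * v' i <= \sum_i lambda i * v i.

Definition heavy_traffic_solution (R : realType) (s : pss R)
    (x : activity s -> R) : Prop :=
  primal_optimal x 1 /\ forall k, server_load x k = 1.

Definition relaxed_heavy_traffic (R : realType) (s : pss R) : Prop :=
  exists x : activity s -> R, heavy_traffic_solution x.

Definition basic (R : realType) (s : pss R) (x : activity s -> R)
    (a : activity s) : Prop :=
  0 < x a.

Definition communicate_directly (R : realType) (s : pss R)
    (k k' : 'I_(nserver s)) : Prop :=
  exists x : activity s -> R, heavy_traffic_solution x /\
  exists a a' : activity s,
    [/\ cls a = cls a', srv a = k, srv a' = k', basic x a & basic x a'].

Definition communicate (R : realType) (s : pss R)
    (k k' : 'I_(nserver s)) : Prop :=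
  connect (fun j j' => `[< communicate_directly j j' >]) k k'.

Definition relaxed_resource_pooling (R : realType) (s : pss R) : Prop :=
  (exists x : activity s -> R, heavy_traffic_solution x) /\
  forall k k' : 'I_(nserver s), communicate k k'.

(** * Routing and scheduling *)

Definition state (R : realType) (s : pss R) : Type :=
  {ffun activity s -> nat}.

HB.instance Definition _ (R : realType) (s : pss R) :=
  Countable.copy (state s) {ffun activity s -> nat}.

Definition jobs (R : realType) (s : pss R) (z : state s) (a : activity s) :
  nat := z a.

Definition server_jobs (R : realType) (s : pss R) (z : state s)
    (k : 'I_(nserver s)) : nat :=
  (\sum_(a : activity s | srv a == k) jobs z a)%N.

Definition workload (R : realType) (s : pss R) (z : state s)
    (k : 'I_(nserver s)) : R :=
  \sum_(a : activity s | srv a == k) mean_service a * (jobs z a)%:R.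

Definition weighted_workload (R : realType) (s : pss R) (z : state s)
    (a : activity s) : R :=
  mean_service a * workload z (srv a).

Definition wwta_argmin (R : realType) (s : pss R) (z : state s)
    (i : 'I_(nclass s)) : {set 'I_(nserver s)} :=
  [set srv a | a : activity s &
    (cls a == i) &&
    [forall b : activity s,
      (cls b == i) ==> (weighted_workload z a <= weighted_workload z b)]]%SET.

(* L^(i)(z); it is None exactly when no server can process class i. *)
Definition wwta (R : realType) (s : pss R) (z : state s)
    (i : 'I_(nclass s)) : option 'I_(nserver s) :=
  [pick k in wwta_argmin z i |
    [forall k' in wwta_argmin z i, (k <= k')%N]].

Definition nonidling_policy (R : realType) (s : pss R)
    (P : state s -> activity s -> R) : Prop :=
  [/\ forall z a, 0 <= P z a <= 1,
      forall z a, jobs z a = 0%N -> P z a = 0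
    & forall z k, (0 < server_jobs z k)%N ->
        \sum_(a : activity s | srv a == k) P z a = 1].

(** * Queue length process *)

Definition arrival_rate (R : realType) (s : pss R) (r : R)
    (i : 'I_(nclass s)) : R :=
  lambda i * (1 - r).

Definition add_job (R : realType) (s : pss R) (z : state s) (a : activity s) :
    state s :=
  [ffun b => (jobs z b + (b == a))%N].

(* The truncation when jobs z a = 0 is harmless: the policy then has P z a = 0. *)
Definition remove_job (R : realType) (s : pss R) (z : state s)
    (a : activity s) : state s :=
  [ffun b => (jobs z b - (b == a))%N].

Definition generator (R : realType) (s : pss R)
    (lam : 'I_(nclass s) -> R) (P : state s -> activity s -> R)
    (f : state s -> R) (z : state s) : R :=
  \sum_i lam i * \sum_(a : activity s | cls a == i)
      (f (add_job z a) - f z) * (wwta z i == Some (srv a))%:R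
  + \sum_k \sum_(a : activity s | srv a == k)
      mu a * P z a * (f (remove_job z a) - f z).

(** * Continuous-time Markov chains on a countable state space *)

Record transition_function (R : realType) (S : countType)
    (p : R -> S -> S -> R) : Prop := TransitionFunction {
  tf_ge0 : forall t x y, 0 <= t -> 0 <= p t x y;
  tf_sum1 : forall t x, 0 <= t ->
    (\esum_(y in [set: S]) (p t x y)%:E = 1)%E;
  tf_0 : forall x y, p 0 x y = (x == y)%:R;
  tf_semigroup : forall t t' x y, 0 <= t -> 0 <= t' ->
    ((p (t + t') x y)%:E =
      \esum_(w in [set: S]) (p t x w * p t' w y)%:E)%E }.

(* The transition rate from x to y is G applied to the indicator function of
   y, evaluated at x.  The generators used here have bounded rates, so they
   determine the transition function. *)
Definition has_generator (R : realType) (S : countType)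
    (p : R -> S -> S -> R) (G : (S -> R) -> S -> R) : Prop :=
  forall x y, (p t x y - (x == y)%:R) / t @[t --> 0^'+] -->
              G (fun w => (w == y)%:R) x.

Definition stationary_distribution (R : realType) (S : countType)
    (p : R -> S -> S -> R) (pi : S -> \bar R) : Prop :=
  [/\ forall x, (0 <= pi x)%E,
      (\esum_(x in [set: S]) pi x = 1)%E
    & forall t y, 0 <= t ->
        (\esum_(x in [set: S]) (pi x * (p t x y)%:E) = pi y)%E].

Definition has_law (R : realType) (S : countType) d (Omega : measurableType d)
    (Pr : probability Omega R) (Z : Omega -> S) (pi : S -> \bar R) : Prop :=
  (forall x, measurable (Z @^-1` [set x])) /\
  (forall x, Pr (Z @^-1` [set x]) = pi x).

Definition reduced_cost (R : realType) (s : pss R)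
    (v : 'I_(nclass s) -> R) (u : 'I_(nserver s) -> R) (a : activity s) : R :=
  u (srv a) - mu a * v (cls a).

(* Main.v *)
Require Import Defs.
From HB Require Import structures.
From mathcomp Require Import all_boot all_order all_algebra.
From mathcomp Require Import all_classical all_reals all_analysis.
From mathcomp Require Import measurable_realfun ring lra.
Import Order.TTheory GRing.Theory Num.Theory.
Import numFieldNormedType.Exports.
Local Open Scope classical_set_scope.
Local Open Scope ring_scope.

Set Implicit Arguments.
Unset Strict Implicit.
Unset Printing Implicit Defensive.

(* Stationarity and bounded convergence of (p_t - id) / t as t -> 0 give
   E[G f(Z)] = 0 for f the indicator of a state, hence for every bounded f; the
   difference quotients are dominated because 1 - p_t(x, x) <= t q(x) with
   bounded rates q.  Taking f(z) = min(z_a, n) and letting n tend to infinity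
   yields the flow balance of each activity a.  The first identity is a linear
   combination of these balances, using that each server is either idle or
   fully busy and that, by LP duality, sum_i lambda_i v_i = sum_k u_k = 1. *)

(** * Linear programming duality *)

Lemma scalar0 (F : pzRingType) (V : lmodType F) (f : V -> F) :
  scalar f -> f 0 = 0.
Proof.
move=> linf; have /eqP := linf 1 0 0.
by rewrite /= scaler0 addr0 mul1r -subr_eq subrr => /eqP.
Qed.

Lemma scalarZ_fun (F : pzRingType) (V : lmodType F) (f : V -> F) c x :
  scalar f -> f (c *: x) = c * f x.
Proof.
by move=> linf; have := linf c x 0; rewrite /= !addr0 scalar0// addr0.
Qed.

(* Bartl's induction on the constraints: if the constraint a_j is needed, some
   x0 with a_j x0 = 1 satisfies the others and violates b; subtracting multiples
   of a_j makes every functional vanish at x0, which disposes of a_j. *)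
Lemma farkas_seq (F : realFieldType) (V : lmodType F) (J : eqType)
    (js : seq J) (a : J -> V -> F) (b : V -> F) :
  uniq js -> (forall j, scalar (a j)) -> scalar b ->
  (forall x, (forall j, j \in js -> a j x <= 0) -> b x <= 0) ->
  exists2 y : J -> F, (forall j, 0 <= y j) &
    forall x, b x = \sum_(j <- js) y j * a j x.
Proof.
elim: js a b => [|j js IH] a b.
  move=> _ lina linb ab; exists (fun=> 0) => // x; rewrite big_nil.
  have b0 z : b z <= 0 by apply: ab.
  by have := b0 x; have := b0 (- 1 *: x); rewrite scalarZ_fun//; lra.
move=> /= /andP[jjs ujs] lina linb ab.
have [ab'|] := pselect (forall x, (forall i, i \in js -> a i x <= 0) -> b x <= 0).
  have [y y0 by_] := IH _ _ ujs lina linb ab'.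
  exists (fun i => if i == j then 0 else y i) => [i|x]; first by case: ifP.
  rewrite by_ big_cons eqxx mul0r add0r; apply: eq_big_seq => i ijs.
  by case: eqP ijs jjs => // -> ->.
move=> /existsNP[x1 /not_implyP[ax1 /negP]]; rewrite -ltNge => bx1.
have ajx1 : 0 < a j x1.
  rewrite ltNge; apply/negP => ajx1; move: bx1; rewrite ltNge ab// => i.
  by rewrite inE => /predU1P[->//|/ax1].
pose x0 := (a j x1)^-1 *: x1.
have ajx0 : a j x0 = 1 by rewrite scalarZ_fun// mulVf// gt_eqF.
have bx0 : 0 < b x0 by rewrite scalarZ_fun// mulr_gt0// invr_gt0.
have ax0 i : i \in js -> a i x0 <= 0.
  by move=> /ax1 h; rewrite scalarZ_fun// pmulr_rle0// invr_gt0.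
pose red (f : V -> F) x := f x - f x0 * a j x.
have lin_red f : scalar f -> scalar (red f).
  by move=> linf c x y; rewrite /red /= linf lina /=; ring.
(* [red f] is [f] composed with the projection onto the kernel of [a j] along [x0], so a point
   satisfying the reduced constraints projects to one satisfying all the original ones. *)
have proj f x : scalar f -> f (- a j x *: x0 + x) = red f x.
  by move=> linf; rewrite linf /red /=; ring.
have [|y y0 by_] := IH _ _ ujs (fun i => lin_red _ (lina i)) (lin_red _ linb).
  move=> x a'x; rewrite -proj//; apply: ab => i.
  by rewrite proj// inE => /predU1P[->|/a'x//]; rewrite /red ajx0 mul1r subrr.
(* The multiplier of [a j] is forced by evaluating the desired identity at [x0], where
   [a j x0 = 1]. *)
pose c := b x0 - \sum_(i <- js) y i * a i x0.
have c0 : 0 <= c.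
  rewrite subr_ge0 (le_trans _ (ltW bx0))// big_seq; apply: sumr_le0 => i ijs.
  by rewrite mulr_ge0_le0 ?ax0.
exists (fun i => if i == j then c else y i) => [i|x]; first by case: ifP.
rewrite big_cons eqxx.
have -> : \sum_(i <- js) (if i == j then c else y i) * a i x =
          \sum_(i <- js) y i * a i x.
  by apply: eq_big_seq => i ijs; case: eqP ijs jjs => // -> ->.
have -> : b x = red b x + b x0 * a j x by rewrite /red subrK.
rewrite by_ mulrBl addrC -addrA; congr (_ + _).
rewrite mulr_suml -sumrN -big_split; apply: eq_bigr => i _ /=.
by rewrite /red; ring.
Qed.

Lemma farkas (F : realFieldType) (V : lmodType F) (J : finType)
    (a : J -> V -> F) (b : V -> F) :
  (forall j, scalar (a j)) -> scalar b ->
  (forall x, (forall j, a j x <= 0) -> b x <= 0) ->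
  exists2 y : J -> F, (forall j, 0 <= y j) &
    forall x, b x = \sum_j y j * a j x.
Proof.
move=> lina linb ab; apply: farkas_seq => // [|x ax].
  exact: index_enum_uniq.
by apply: ab => j; apply: ax; rewrite mem_index_enum.
Qed.

Section duality.
Context (R : realType) (s : pss R).
Implicit Types (v : 'I_(nclass s) -> R) (u : 'I_(nserver s) -> R).

Lemma sum_activity (I : finType) (g : activity s -> I) (F : activity s -> R) :
  \sum_i \sum_(a : activity s | g a == i) F a = \sum_a F a.
Proof.
rewrite (exchange_big_dep xpredT)//=; apply: eq_bigr => a _.
by rewrite (big_pred1 (g a))// => i; rewrite eq_sym.
Qed.

(** Both sides are compared with the sum of [x a * u (srv a)]: the flow equations and dual
    constraints bound it from below, the capacities from above. Keeping the sum of [u] as the bound,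
    instead of 1, later forces that sum to equal 1. *)
Lemma weak_duality (x : activity s -> R) v u :
  primal_feasible x 1 -> dual_feasible v u ->
  \sum_i lambda i * v i <= \sum_k u k.
Proof.
move=> [x0 _ xl xk] [u0 uv _].
apply: (@le_trans _ _ (\sum_(a : activity s) x a * u (srv a))).
  rewrite -(sum_activity (@cls R s)); apply: ler_sum => i _.
  rewrite -xl mulr_suml; apply: ler_sum => a /eqP <-.
  by rewrite mulrAC mulrC ler_wpM2l.
rewrite -(sum_activity (@srv R s)); apply: ler_sum => k _.
rewrite (eq_bigr (fun a => x a * u k)); last by move=> a /eqP <-.
by rewrite -mulr_suml -[leRHS]mul1r ler_wpM2r ?xk.
Qed.

(* Farkas' lemma in the variables ((x, rho), t) for the homogenized primal, in
   which the arrival rates are t * lambda: optimality of 1 says that t <= rho. *)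
Lemma dual_attained (x : activity s -> R) :
  primal_optimal x 1 ->
  exists v u, dual_feasible v u /\ \sum_i lambda i * v i = 1.
Proof.
move=> [xf xopt].
pose V : lmodType R := (({ffun activity s -> R^o} * R^o) * R^o)%type.
pose flow i (w : V) : R :=
  \sum_(a : activity s | cls a == i) mu a * w.1.1 a - w.2 * lambda i.
pose cap k (w : V) : R := \sum_(a : activity s | srv a == k) w.1.1 a - w.1.2.
pose J : finType := ((activity s + unit) + ('I_(nclass s) * bool + 'I_(nserver s)))%type.
(* Every constraint takes the form [<= 0], so signs are flipped for nonnegativity, and each flow
   equality becomes two inequalities indexed by a boolean. *)
pose con (j : J) (w : V) : R := match j with
  | inl (inl a) => - w.1.1 a
  | inl (inr _) => - w.1.2
  | inr (inl (i, e)) => if e then flow i w else - flow i w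
  | inr (inr k) => cap k w end.
have lin_flow i : scalar (flow i).
  move=> c w w'; rewrite /flow /=.
  rewrite (eq_bigr (fun a => c * (mu a * w.1.1 a) + mu a * w'.1.1 a)); last first.
    by move=> a _; rewrite !ffunE /= /GRing.scale /=; ring.
  by rewrite big_split /= -mulr_sumr /GRing.scale /=; ring.
have lin_con j : scalar (con j).
  move: j => [[a|[]]|[[i []]|k]] c w w' /=.
  - by rewrite !ffunE /GRing.scale /=; ring.
  - by rewrite /GRing.scale /=; ring.
  - exact: lin_flow.
  - by rewrite lin_flow /=; ring.
  - rewrite /cap /= (eq_bigr (fun a => c * w.1.1 a + w'.1.1 a)); last first.
      by move=> a _; rewrite !ffunE.
    by rewrite big_split /= -mulr_sumr /GRing.scale /=; ring.
pose obj (w : V) : R := w.2 - w.1.2.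
have lin_obj : scalar obj by move=> c w w'; rewrite /obj /= /GRing.scale /=; ring.
have [|y y0 yE] := farkas lin_con lin_obj.
  move=> w cw; rewrite /obj subr_le0.
  have w0 a : 0 <= w.1.1 a by have := cw (inl (inl a)); rewrite /= oppr_le0.
  have rho0 : 0 <= w.1.2 by have := cw (inl (inr tt)); rewrite /= oppr_le0.
  have [t0|t0] := leP w.2 0; first exact: le_trans rho0.
  (* For [t > 0], dividing by [t] gives a feasible point of the original problem, whose value
     [rho / t] is at least 1. *)
  rewrite -[leRHS](mulVKf (lt0r_neq0 t0)) ler_pMr//.
  apply: (xopt (fun a => w.2^-1 * w.1.1 a)); split.
  - by move=> a; rewrite mulr_ge0// invr_ge0 ltW.
  - by rewrite mulr_ge0// invr_ge0 ltW.
  - move=> i.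
    have fl0 : flow i w = 0.
      have := cw (inr (inl (i, true))); have := cw (inr (inl (i, false))).
      by rewrite /=; lra.
    move: fl0; rewrite /flow => /eqP; rewrite subr_eq0 => /eqP fl0.
    rewrite (eq_bigr (fun a => w.2^-1 * (mu a * w.1.1 a))); last first.
      by move=> a _; ring.
    by rewrite -mulr_sumr fl0 mulKf// gt_eqF.
  - move=> k; rewrite /server_load -mulr_sumr ler_pM2l ?invr_gt0//.
    by have := cw (inr (inr k)); rewrite /= /cap subr_le0.
(* The free dual variable of an equality is the difference of the multipliers of its two
   inequalities; this order makes it enter [objE] as [- v i * flow i w]. *)
pose v i := y (inr (inl (i, false))) - y (inr (inl (i, true))).
pose u k := y (inr (inr k)).
have objE w : obj w = \sum_(a : activity s) y (inl (inl a)) * - w.1.1 a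
    + y (inl (inr tt)) * - w.1.2 - \sum_i v i * flow i w + \sum_k u k * cap k w.
  rewrite yE !big_sumType /= [X in _ + X + _ = _](big_pred1 tt); last by case.
  rewrite -!addrA; congr (_ + (_ + (_ + _))).
  rewrite (eq_bigr (fun q => (fun i e => y (inr (inl (i, e))) *
    (if e then flow i w else - flow i w)) q.1 q.2)); last by move=> [].
  rewrite -(pair_bigA _ (fun i e => y (inr (inl (i, e))) *
    (if e then flow i w else - flow i w))) /= -sumrN; apply: eq_bigr => i _.
  by rewrite big_bool /= /v; ring.
(* The identity [objE] is tested on basis vectors: [t = 1] gives the dual value, the indicator of
   [a] gives the constraint at [a], and [rho = 1] gives the bound on the sum of [u]. The multipliers
   of the sign constraints are the dual slacks. *)
exists v, u; split; last first.
  have := objE (([ffun=> 0], 0), 1); rewrite /obj /= subr0 => ->; apply/esym.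
  rewrite big1 => [|a _]; last by rewrite /= ffunE oppr0 mulr0.
  rewrite oppr0 mulr0 !add0r [X in _ + X]big1 => [|k _]; last first.
    by rewrite /cap big1/= ?subrr ?mulr0// => a _; rewrite ffunE.
  rewrite addr0 -sumrN; apply: eq_bigr => i _.
  rewrite /flow big1 => [|a _]; last by rewrite /= ffunE mulr0.
  by rewrite /=; ring.
split=> [k|a|]; first exact: y0.
- have := objE (([ffun b => (b == a)%:R], 0), 0); rewrite /obj /= subr0.
  rewrite (bigD1 a)//= big1 ?addr0; last first.
    by move=> b /negPf ba; rewrite /= ffunE ba oppr0 mulr0.
  rewrite ffunE eqxx oppr0 mulr0 addr0.
  rewrite (bigD1 (cls a))//= [X in _ - (_ + X)]big1 ?addr0; last first.
    move=> i ia; rewrite /flow mul0r subr0 big1 ?mulr0// => b /eqP bi.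
    by rewrite /= ffunE; case: (b =P a) ia => [<-|]; rewrite ?bi ?eqxx// mulr0.
  rewrite /flow /= mul0r subr0 (bigD1 a)//= big1 ?addr0; last first.
    by move=> b /andP[_ /negPf ba]; rewrite ffunE ba mulr0.
  rewrite ffunE eqxx mulr1.
  rewrite (bigD1 (srv a))//= [X in _ + (_ + X)]big1 ?addr0; last first.
    move=> k ka; rewrite /cap subr0 big1 ?mulr0// => b /eqP bk.
    by rewrite /= ffunE; case: (b =P a) ka => [<-|]; rewrite ?bk ?eqxx.
  rewrite /cap /= subr0 (bigD1 a)//= big1 ?addr0; last first.
    by move=> b /andP[_ /negPf ba]; rewrite ffunE ba.
  by rewrite /= ffunE eqxx mulr1; have := y0 (inl (inl a)); lra.
- have := objE (([ffun=> 0], 1), 0); rewrite /obj /= sub0r.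
  rewrite big1 => [|a _]; last by rewrite /= ffunE oppr0 mulr0.
  rewrite [X in _ - X]big1 => [|i _]; last first.
    by rewrite /flow mul0r subr0 big1 ?mulr0// => a _; rewrite ffunE mulr0.
  rewrite (eq_bigr (fun k => - u k)) => [|k _]; last first.
    by rewrite /cap big1/= ?sub0r ?mulrN1// => a _; rewrite ffunE.
  by rewrite sumrN; have := y0 (inl (inr tt)); lra.
Qed.

(** Optimality against the attained value 1, weak duality and dual feasibility close the chain: 1 is
    at most the dual value, which is at most the sum of [u], which is at most 1. *)
Lemma dual_optimal_value (x : activity s -> R) v u :
  primal_optimal x 1 -> dual_optimal v u ->
  \sum_i lambda i * v i = 1 /\ \sum_k u k = 1.
Proof.
move=> xopt [vuf vuopt]; have [v' [u' [vuf' v1]]] := dual_attained xopt.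
have := vuopt _ _ vuf'; rewrite v1.
have := weak_duality xopt.1 vuf; case: vuf => _ _; lra.
Qed.

End duality.

(** * Means of functions of a discrete random variable *)

Section law.
Context (R : realType) (S : countType) (d : measure_display).
Context (Omega : measurableType d) (Pr : probability Omega R).
Context (Z : Omega -> S) (pi : S -> \bar R).
Hypothesis ZP : has_law Pr Z pi.

(** As [S] is countable, the preimage is a countable union of measurable fibres. *)
Lemma measurable_law_preimage (A : set S) : measurable (Z @^-1` A).
Proof.
rewrite (_ : Z @^-1` A =
    \bigcup_x if `[< A x >] then Z @^-1` [set x] else set0).
  apply: countable_bigcupT_measurable => [|x]; first exact: countableP.
  by case: ifP => // _; case: ZP.
apply/seteqP; split=> [w Aw|w [x _]]; first by exists (Z w) => //; rewrite asboolT.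
by case: asboolP => // Ax /= ->.
Qed.

Lemma measurable_law_comp d' (T : measurableType d') (f : S -> T) :
  measurable_fun setT (f \o Z).
Proof.
move=> _ B mB; rewrite setTI comp_preimage; exact: measurable_law_preimage.
Qed.

Lemma integrable_law_comp (f : S -> R) C : (forall x, `|f x| <= C) ->
  Pr.-integrable setT (EFin \o (f \o Z)).
Proof.
move=> fC; apply: measurable_bounded_integrable => //.
- by apply: le_lt_trans (probability_le1 Pr _) (ltry _).
- exact: measurable_law_comp.
- exists C; split; first by rewrite num_real.
  by move=> M CM w _ /=; rewrite (le_trans (fC _))// ltW.
Qed.

(** This gives access to the exchange of integrals with series over the naturals; numbers that
    encode no state contribute the default 0. *)
Lemma esum_pickle (h : S -> \bar R) : (forall x, 0 <= h x)%E ->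
  (\esum_(x in [set: S]) h x = \sum_(n <oo) oapp h 0 (pickle_inv n))%E.
Proof.
move=> h0; rewrite nneseries_esumT; last first.
  by move=> n; case: pickle_inv => //=.
rewrite (esumID (range (@pickle S)))//; last by move=> n _; case: pickle_inv => //=.
rewrite [X in (_ + X)%E]esum1 ?adde0; last first.
  move=> n [_ nr]; have := @pickle_invK S n; case: pickle_inv => //= x xn.
  by exfalso; apply: nr; exists x.
rewrite setTI (reindex_esum [set: S] _ pickle).
  by apply: eq_esum => x _; rewrite pickleK_inv.
split=> // x y _ _ xy; apply: (pcan_inj pickleK_inv); exact: xy.
Qed.

(** Expand [f (Z w)] as the sum over [x] of [f x] times the indicator of [Z = x], then integrate the
    nonnegative series term by term. *)
Lemma integral_law (f : S -> R) : (forall x, 0 <= f x) ->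
  (\int[Pr]_w (f (Z w))%:E = \esum_(x in [set: S]) (pi x * (f x)%:E))%E.
Proof.
move=> f0; have [_ PZ] := ZP.
have h0 x w : (0 <= (f x)%:E * (\1_(Z @^-1` [set x]) w)%:E)%E.
  by rewrite -EFinM lee_fin mulr_ge0.
have pi0 x : (0 <= pi x)%E by rewrite -PZ.
rewrite esum_pickle; last first.
  by move=> x; rewrite mule_ge0// lee_fin; exact: f0.
pose g n w : \bar R :=
  oapp (fun x => ((f x)%:E * (\1_(Z @^-1` [set x]) w)%:E)%E) 0%E (pickle_inv n).
rewrite (eq_integral (fun w => \sum_(n <oo) g n w)%E) => [|w _]; last first.
  rewrite -(esum_pickle (h := fun x => (f x)%:E * (\1_(Z @^-1` [set x]) w)%:E)%E).
    rewrite (esumID [set Z w])//; rewrite setTI esum_set1//.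
    rewrite [X in (_ + X)%E]esum1 ?adde0 => [|x [_ xZ]].
      by rewrite indicE mem_set// mule1.
    by rewrite indicE memNset ?mule0// => /= Zx; apply: xZ.
  by move=> x; exact: h0.
rewrite integral_nneseries//.
- apply: eq_eseriesr => n _; rewrite /g; case: pickle_inv => [x|] /=.
    rewrite integralZl//; last exact/integrable_indic/measurable_law_preimage.
    rewrite integral_indic ?setIT//; last exact: measurable_law_preimage.
    by rewrite muleC; congr (_ * _)%E; exact: PZ.
  by rewrite integral0.
- move=> n; rewrite /g; case: pickle_inv => [x|] //=.
  apply: (measurable_int Pr); apply: integrableZl => //.
  exact/integrable_indic/measurable_law_preimage.
- by move=> n w _; rewrite /g; case: pickle_inv => [x|] /=.
Qed.

Definition law_mean (f : S -> R) : R := \int[Pr]_w f (Z w).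

Lemma law_mean_cst c : law_mean (fun=> c) = c.
Proof.
by rewrite /law_mean Rintegral_cst// [X in fine X]probability_setT mulr1.
Qed.

Lemma law_meanE (f : S -> R) C : (forall x, `|f x| <= C) ->
  (\int[Pr]_w (f (Z w))%:E)%E = (law_mean f)%:E.
Proof.
by move=> fC; rewrite fineK//; apply: integrable_fin_num => //; exact: integrable_law_comp fC.
Qed.

Lemma law_meanD (f g : S -> R) C D :
  (forall x, `|f x| <= C) -> (forall x, `|g x| <= D) ->
  law_mean (fun x => f x + g x) = law_mean f + law_mean g.
Proof.
by move=> fC gD; rewrite /law_mean RintegralD//;
  [exact: integrable_law_comp fC|exact: integrable_law_comp gD].
Qed.

Lemma law_meanZ (f : S -> R) C c : (forall x, `|f x| <= C) ->
  law_mean (fun x => c * f x) = c * law_mean f.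
Proof. by move=> fC; rewrite /law_mean RintegralZl//; exact: integrable_law_comp fC. Qed.

Lemma law_mean_sum (I : Type) (r : seq I) (Q : pred I) (f : I -> S -> R) (C : I -> R) :
  (forall i x, `|f i x| <= C i) ->
  law_mean (fun x => \sum_(i <- r | Q i) f i x) = \sum_(i <- r | Q i) law_mean (f i).
Proof.
move=> fC; elim: r => [|i r IH].
  by rewrite big_nil -[RHS](law_mean_cst 0); congr law_mean; apply/funext => x; rewrite big_nil.
rewrite big_cons -IH; case: ifPn => Qi.
  rewrite -(law_meanD (fC i) (D := \sum_(j <- r | Q j) C j)).
    by congr law_mean; apply/funext => x; rewrite big_cons Qi.
  by move=> x; rewrite (le_trans (ler_norm_sum _ _ _))// ler_sum.
by congr law_mean; apply/funext => x; rewrite big_cons (negPf Qi).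
Qed.

Lemma law_mean_cvg (f_ : nat -> S -> R) (f : S -> R) C :
  (forall n x, `|f_ n x| <= C) -> (forall x, f_ n x @[n --> \oo] --> f x) ->
  law_mean (f_ n) @[n --> \oo] --> law_mean f.
Proof.
move=> fC ff.
have [] := @dominated_convergence _ _ _ Pr setT measurableT
  (fun n w => (f_ n (Z w))%:E) (fun w => (f (Z w))%:E) (fun=> C%:E).
- by move=> n; apply/measurable_EFinP; exact: measurable_law_comp.
- apply/measurable_EFinP; exact: measurable_law_comp.
- by apply: aeW => w _; apply: cvg_EFin; [exact: nearW|exact: ff].
- exact: finite_measure_integrable_cst.
- by apply: aeW => w n _; rewrite lee_fin.
move=> fi _; rewrite -(fineK (integrable_fin_num measurableT fi)) => /fine_cvgP[_].
exact.
Qed.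

End law.

(** * Stationary continuous-time Markov chains *)

Section transition.
Context (R : realType) (S : countType) (p : R -> S -> S -> R).
Hypothesis pP : transition_function p.

Lemma tf_le_compl t x y : 0 <= t -> x != y -> p t x y <= 1 - p t x x.
Proof.
move=> t0 xy; rewrite lerBrDl -lee_fin -(tf_sum1 pP x t0).
apply: esum_ge; exists ([set x] `|` [set y]).
  by split=> //; rewrite finite_setU.
rewrite fsbigU//=; last by move=> z [-> /= /eqP]; rewrite (negPf xy).
by rewrite !fsbig_set1 EFinD.
Qed.

Lemma tf_le1 t x : 0 <= t -> p t x x <= 1.
Proof.
move=> t0; rewrite -lee_fin -(tf_sum1 pP x t0).
apply: esum_ge; exists [set x]; first by split.
by rewrite fsbig_set1.
Qed.

Lemma tf_semigroup_ge t t' x : 0 <= t -> 0 <= t' ->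
  p t x x * p t' x x <= p (t + t') x x.
Proof.
move=> t0 t'0; rewrite -lee_fin (tf_semigroup pP)//.
apply: esum_ge; exists [set x]; first by split.
by rewrite fsbig_set1.
Qed.

(** Induction on [n]: staying at [x] is supermultiplicative in time, and
    [1 - a * b <= (1 - a) + (1 - b)] for [a], [b] in the unit interval. *)
Lemma tf_escape_subadd n t x : 0 <= t ->
  1 - p (n%:R * t) x x <= n%:R * (1 - p t x x).
Proof.
move=> t0; elim: n => [|n IH]; first by rewrite !mul0r (tf_0 pP) eqxx subrr.
rewrite -natr1 !mulrDl !mul1r.
have nt0 : 0 <= n%:R * t by rewrite mulr_ge0.
have := tf_semigroup_ge x nt0 t0.
have := tf_le1 x nt0; have := tf_le1 x t0.
have := tf_ge0 pP x x nt0; have := tf_ge0 pP x x t0.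
move: IH; nra.
Qed.

Variable G : (S -> R) -> S -> R.
Hypothesis pG : has_generator p G.

(* Splitting [0, t] into n steps bounds 1 - p t x x by n (1 - p (t / n) x x),
   whose limit is t times the rate of leaving x. *)
Lemma tf_escape_rate t x : 0 < t ->
  1 - p t x x <= t * - G (fun w => (w == x)%:R) x.
Proof.
move=> t0; pose h n : R := t / n.+1%:R.
have h0 n : 0 < h n by rewrite divr_gt0.
have hcvg : h n @[n --> \oo] --> 0.
  by rewrite -[X in _ --> X](mulr0 t); apply: cvgMr; exact: cvg_harmonic.
have hG := (cvg_at_rightP _ _ _).1 (@pG x x) h (conj h0 hcvg).
rewrite mulrN lerNr mulrC -ler_pdivlMr//; apply: (cvgr_to_le hG).
apply: nearW => n; rewrite eqxx /=.
rewrite ler_pdivrMr// (_ : _ / t * h n = - (1 - p t x x) / n.+1%:R); last first.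
  by rewrite /h; field; rewrite nat1r pnatr_eq0 lt0r_neq0.
rewrite ler_pdivlMr//; have := tf_escape_subadd n.+1 x (ltW (h0 n)).
by rewrite [_ * h n]mulrC divfK ?pnatr_eq0//; lra.
Qed.

(** On and off the diagonal the increment is at most [1 - p t x x]. The bound is uniform in [t] and
    [x], as dominated convergence requires. *)
Lemma tf_rate_bound K t x y : (forall x, - G (fun w => (w == x)%:R) x <= K) ->
  0 < t -> `|(p t x y - (x == y)%:R) / t| <= K.
Proof.
move=> GK t0; rewrite normrM [`|t^-1|]gtr0_norm ?invr_gt0// ler_pdivrMr// mulrC.
have esc : 1 - p t x x <= t * K.
  by rewrite (le_trans (tf_escape_rate x t0))// ler_pM2l.
have [<-|xy] := eqVneq x y.
  by rewrite distrC ger0_norm// subr_ge0 tf_le1// ltW.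
rewrite subr0 ger0_norm; last by rewrite (tf_ge0 pP)// ltW.
by rewrite (le_trans (tf_le_compl (ltW t0) xy)).
Qed.

Context (d : measure_display) (Omega : measurableType d).
Context (Pr : probability Omega R) (Z : Omega -> S) (pi : S -> \bar R).
Hypothesis ZP : has_law Pr Z pi.
Hypothesis piP : stationary_distribution p pi.

Lemma law_mean_transition t y : 0 <= t ->
  law_mean Pr Z (fun x => p t x y - (x == y)%:R) = 0.
Proof.
move=> t0; have [_ _ pit] := piP.
have pb x : `|p t x y| <= 1.
  rewrite ger0_norm ?(tf_ge0 pP)//; have [->|xy] := eqVneq x y; first exact: tf_le1.
  by rewrite (le_trans (tf_le_compl t0 xy))// lerBlDr lerDl (tf_ge0 pP).
have db x : `|- (x == y)%:R : R| <= 1 by rewrite normrN; case: eqP; rewrite ?normr1 ?normr0.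
rewrite (law_meanD ZP pb db); apply/eqP.
have db' x : `|(x == y)%:R : R| <= 1 by rewrite -normrN.
rewrite (_ : (fun x => - (x == y)%:R) = fun x => -1 * (x == y)%:R); last first.
  by apply/funext => x; rewrite mulN1r.
rewrite (law_meanZ ZP _ db') mulN1r subr_eq0 -eqe.
rewrite -(law_meanE ZP pb) -(law_meanE ZP db').
rewrite (integral_law ZP (f := fun x => p t x y)); last first.
  by move=> x; exact: (tf_ge0 pP).
rewrite (integral_law ZP (f := fun x => (x == y)%:R))//.
(* Since [p 0] is the identity, the mean of the indicator is also [pi y], by stationarity at time
   0. *)
rewrite pit//; rewrite -(pit 0 y)//; apply/eqP/eq_esum => x _.
by rewrite (tf_0 pP).
Qed.

Lemma stationary_balance K y : (forall x, - G (fun w => (w == x)%:R) x <= K) ->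
  law_mean Pr Z (G (fun w => (w == y)%:R)) = 0.
Proof.
move=> GK; pose h n : R := n.+1%:R^-1.
have h0 n : 0 < h n by rewrite invr_gt0.
have hl := law_mean_cvg ZP (fun n x => tf_rate_bound x y GK (h0 n))
  (fun x => (cvg_at_rightP _ _ _).1 (@pG x y) h (conj h0 cvg_harmonic)).
apply/esym/(cvg_unique _ _ hl); first exact: norm_hausdorff.
rewrite (_ : (fun n => _) = fun=> 0); first exact: cvg_cst.
apply/funext => n; rewrite -[RHS](mulr0 (h n)^-1) -(law_mean_transition y (ltW (h0 n))).
rewrite -(law_meanZ ZP _ (C := K * h n)).
  by congr law_mean; apply/funext => x; rewrite mulrC.
move=> x; rewrite -ler_pdivrMr//; have := tf_rate_bound x y GK (h0 n).
by rewrite normrM [`|(h n)^-1|]gtr0_norm ?invr_gt0.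
Qed.

End transition.

(** * Stationarity of the queue length process *)

Section generator.
Context (R : realType) (s : pss R) (lam : 'I_(nclass s) -> R).
Context (P : state s -> activity s -> R).
Hypothesis lam0 : forall i, 0 <= lam i.
Hypothesis polP : nonidling_policy P.
Local Notation G := (generator lam P).

Lemma generatorE f z : G f z = \sum_(a : activity s)
  (lam (cls a) * (wwta z (cls a) == Some (srv a))%:R * (f (add_job z a) - f z)
   + mu a * P z a * (f (remove_job z a) - f z)).
Proof.
rewrite big_split /=; congr (_ + _); last by rewrite sum_activity.
rewrite -(sum_activity (@cls R s)); apply: eq_bigr => i _.
by rewrite mulr_sumr; apply: eq_bigr => a /eqP <-; ring.
Qed.

Lemma generator_sum (I : Type) (r : seq I) (c : I -> R) (f : I -> state s -> R) z :
  G (fun w => \sum_(i <- r) c i * f i w) z = \sum_(i <- r) c i * G (f i) z.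
Proof.
rewrite generatorE; under eq_bigr do rewrite -!sumrB !mulr_sumr -big_split /=.
rewrite exchange_big; apply: eq_bigr => i _.
by rewrite generatorE mulr_sumr; apply: eq_bigr => a _; ring.
Qed.

(** A crude bound on the total jump rate out of any state, with each routing indicator and effort
    fraction replaced by 1. *)
Definition rate_bound : R := \sum_(a : activity s) (lam (cls a) + mu a).

Lemma generator_bound f z M : 0 <= M ->
  (forall a, `|f (add_job z a) - f z| <= M) ->
  (forall a, `|f (remove_job z a) - f z| <= M) ->
  `|G f z| <= M * rate_bound.
Proof.
move=> M0 fadd frem; rewrite generatorE mulr_sumr.
apply: le_trans (ler_norm_sum _ _ _) _; apply: ler_sum => a _.
rewrite [leRHS]mulrDr; apply: le_trans (ler_normD _ _) _; rewrite lerD//.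
  rewrite normrM [leRHS]mulrC ler_pM// normrM ger0_norm// -[leRHS]mulr1 ler_pM//.
  by case: eqP; rewrite ?normr1 ?normr0.
rewrite normrM [leRHS]mulrC ler_pM// normrM gtr0_norm ?mu_gt0//.
have [/(_ z a)/andP[p0 p1] _ _] := polP.
by rewrite -[leRHS]mulr1 ler_pM// ?ger0_norm// ltW// mu_gt0.
Qed.

Lemma generator_bounded f M z : (forall w, `|f w| <= M) ->
  `|G f z| <= (M + M) * rate_bound.
Proof.
move=> fM; have M0 : 0 <= M by apply: le_trans (fM z).
by apply: generator_bound => [|a|a]; rewrite ?addr_ge0//;
  apply: le_trans (ler_normB _ _) _; rewrite lerD.
Qed.

Lemma generator_capped a n z :
  G (fun w => (minn (jobs w a) n)%:R) z =
    lam (cls a) * (wwta z (cls a) == Some (srv a))%:R * (jobs z a < n)%N%:R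
    - mu a * P z a * (jobs z a <= n)%N%:R.
Proof.
rewrite generatorE (bigD1 a)//= big1 ?addr0; last first.
  move=> b /negPf ba.
  have -> : jobs (add_job z b) a = jobs z a by rewrite /jobs ffunE eq_sym ba addn0.
  have -> : jobs (remove_job z b) a = jobs z a by rewrite /jobs ffunE eq_sym ba subn0.
  by rewrite subrr !mulr0 addr0.
have -> : jobs (add_job z a) a = (jobs z a).+1 by rewrite /jobs ffunE eqxx addn1.
have -> : jobs (remove_job z a) a = (jobs z a).-1 by rewrite /jobs ffunE eqxx subn1.
congr (_ + _).
  congr (_ * _); case: (ltnP (jobs z a) n) => h.
    by rewrite (minn_idPl h) -natr1 addrC addKr.
  by rewrite (minn_idPr (leqW h)) subrr.
(* With no job of [a] present, the removal changes nothing although the indicator is 1; the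
   vanishing of [P z a] reconciles the two sides. *)
rewrite -mulrN; have [_ /(_ z a) P0 _] := polP.
case: (jobs z a) P0 => [->//|m _ /=]; first by rewrite mulr0 !mul0r.
congr (_ * _); case: (leqP m.+1 n) => h.
  by rewrite (minn_idPl (ltnW h)) -natr1 opprD addrA subrr sub0r.
by rewrite (minn_idPr _) ?subrr ?oppr0// -ltnS.
Qed.

Context (p : R -> state s -> state s -> R) (d : measure_display).
Context (Omega : measurableType d) (Pr : probability Omega R).
Context (Z : Omega -> state s) (pi : state s -> \bar R).
Hypothesis pP : transition_function p.
Hypothesis pG : has_generator p G.
Hypothesis piP : stationary_distribution p pi.
Hypothesis ZP : has_law Pr Z pi.
Local Notation E := (law_mean Pr Z).

Lemma law_mean_generator_indic y : E (G (fun w => (w == y)%:R)) = 0.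
Proof.
apply: (stationary_balance pP pG ZP piP (K := (1 + 1) * rate_bound)) => x.
apply: le_trans (ler_norm _) _; rewrite normrN; apply: generator_bounded => w.
by case: eqP; rewrite ?normr1 ?normr0.
Qed.

(* The truncations of f to the first N states of the enumeration are finite
   combinations of indicators, and G f z only involves finitely many states. *)
Lemma law_mean_generator f M : (forall w, `|f w| <= M) -> E (G f) = 0.
Proof.
move=> fM; pose coef n : R := oapp f 0 (pickle_inv n).
pose ind n (w : state s) : R := oapp (fun y => (w == y)%:R) 0 (pickle_inv n).
pose f_ N w : R := \sum_(n <- iota 0 N) coef n * ind n w.
have f_E N w : f_ N w = if (pickle w < N)%N then f w else 0.
  rewrite /f_; case: ifP => wN.
    rewrite (bigD1_seq (pickle w)) ?iota_uniq ?mem_iota//=.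
    rewrite /coef /ind pickleK_inv /= eqxx mulr1 big1 ?addr0// => n nw.
    have := @pickle_invK (state s) n; case: pickle_inv => [y|] /=; last by rewrite mulr0.
    by move=> yn; case: (w =P y) nw => [->|]; rewrite -?yn ?eqxx ?mulr0.
  rewrite big_seq big1// => n; rewrite mem_iota /= add0n /coef /ind => nN.
  have := @pickle_invK (state s) n; case: pickle_inv => [y|] /=; last by rewrite mulr0.
  by move=> yn; case: (w =P y) nN => [wy|]; rewrite -?yn ?mulr0// -wy wN.
have M0 : 0 <= M by apply: le_trans (fM [ffun=> 0%N]).
have f_M N w : `|f_ N w| <= M by rewrite f_E; case: ifP => // _; rewrite normr0.
have Gf_M N z : `|G (f_ N) z| <= (M + M) * rate_bound by apply: generator_bounded.
have ind1 n w : `|ind n w| <= 1.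
  rewrite /ind; case: pickle_inv => [y|] /=; last by rewrite normr0.
  by case: eqP; rewrite ?normr1 ?normr0.
have Gf_0 N : E (G (f_ N)) = 0.
  have -> : G (f_ N) = fun z => \sum_(n <- iota 0 N) coef n * G (ind n) z.
    by apply/funext => z; rewrite -generator_sum.
  have Gind n z := generator_bounded z (ind1 n).
  rewrite (law_mean_sum ZP _ _ (C := fun n => `|coef n| * ((1 + 1) * rate_bound))).
    apply: big1 => n _; rewrite (law_meanZ ZP _ (Gind n)).
    rewrite /ind; case: pickle_inv => [y|] /=.
      by rewrite law_mean_generator_indic mulr0.
    rewrite (_ : G _ = fun=> 0) ?law_mean_cst ?mulr0//.
    by apply/funext => z; rewrite generatorE big1// => a _; rewrite subrr !mulr0 addr0.
  by move=> n z; rewrite normrM ler_wpM2l.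
have f_cvg z : f_ N z @[N --> \oo] --> f z.
  apply: cvg_near_cst; exists (pickle z).+1 => // N /= zN.
  by rewrite f_E zN.
have Gf_cvg z : G (f_ N) z @[N --> \oo] --> G f z.
  rewrite generatorE; under eq_fun do rewrite generatorE.
  apply: cvg_big => [x|a _]; first exact: add_continuous.
  apply: cvgD; apply: cvgMr; exact: cvgB.
have := law_mean_cvg ZP Gf_M Gf_cvg; under eq_fun do rewrite Gf_0.
by move=> h; apply/esym/(cvg_unique _ _ h) => //; exact: cvg_cst.
Qed.

(* Since Z^(r) is not known to have a finite mean, the coordinate z_a is capped
   at n; the capped generator stays bounded as n tends to infinity. *)
Lemma activity_balance a : E (fun z => lam (cls a) * (wwta z (cls a) == Some (srv a))%:R
  - mu a * P z a) = 0.
Proof.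
pose f n (w : state s) : R := (minn (jobs w a) n)%:R.
have Gf0 n : E (G (f n)) = 0.
  apply: (law_mean_generator (M := n%:R)) => w.
  by rewrite ger0_norm// ler_nat geq_minr.
have fK n w : `|G (f n) w| <= 1 * rate_bound.
  (* Capping does not increase distances, so one jump changes [f n] by at most 1; the sup-norm bound
     of [generator_bounded] would grow with [n]. *)
  have close m m' : (m <= m'.+1)%N -> (m' <= m.+1)%N ->
      `|(minn m n)%:R - (minn m' n)%:R : R| <= 1.
    move=> mm' m'm; have min_le u v : (u <= v.+1 -> minn u n <= (minn v n).+1)%N.
      by rewrite -minnSS leq_min geq_min => ->; rewrite geq_min leqnSn orbT.
    have h1 : (minn m n)%:R <= (minn m' n)%:R + 1 :> R by rewrite natr1 ler_nat min_le.
    have h2 : (minn m' n)%:R <= (minn m n)%:R + 1 :> R by rewrite natr1 ler_nat min_le.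
    by rewrite ler_norml; apply/andP; split; lra.
  apply: generator_bound => // b; apply: close; rewrite /jobs ffunE.
  - by rewrite -addn1 leq_add2l; case: eqP.
  - by rewrite ltnW// ltnS leq_addr.
  - by rewrite (leq_trans (leq_subr _ _)).
  - by case: eqP => _; rewrite ?subn0 ?subn1 ?leqnSn ?leqSpred.
have f_cvg z : G (f n) z @[n --> \oo] -->
    lam (cls a) * (wwta z (cls a) == Some (srv a))%:R - mu a * P z a.
  (* Once the cap exceeds the coordinate, both indicators of [generator_capped] equal 1. *)
  apply: cvg_near_cst; exists (jobs z a).+1 => // n /= zn.
  by rewrite generator_capped zn (ltnW zn) !mulr1.
have := law_mean_cvg ZP fK f_cvg; under eq_fun do rewrite Gf0.
by move=> h; apply/esym/(cvg_unique _ _ h) => //; exact: cvg_cst.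
Qed.

End generator.

(** * Each arrival is routed to one server, and each server is idle or fully busy *)

Section routing.
Context (R : realType) (s : pss R).

Lemma activity_inj (a b : activity s) : cls a = cls b -> srv a = srv b -> a = b.
Proof.
case: a b => [[i k] ik] [[i' k'] ik']; rewrite /cls /srv /= => ii' kk'.
by apply: val_inj; rewrite /= ii' kk'.
Qed.

Lemma wwta_some (z : state s) (a : activity s) :
  exists2 b : activity s, cls b = cls a & wwta z (cls a) = Some (srv b).
Proof.
have [b0 /eqP b0a b0min] := @arg_minP _ _ _ a (fun b => cls b == cls a)
  (weighted_workload z) (eqxx _).
have b0A : srv b0 \in wwta_argmin z (cls a).
  apply/imsetP; exists b0 => //; rewrite inE b0a eqxx /=.
  by apply/forallP => b; apply/implyP; exact: b0min.
rewrite /wwta; case: pickP => [k /andP[/imsetP[b]]|noL].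
  by rewrite inE => /andP[/eqP ba _] -> _; exists b.
have [k kA kmin] := @arg_minnP _ (srv b0) (mem (wwta_argmin z (cls a)))
  (@nat_of_ord _) b0A.
have := noL k; rewrite [k \in _]kA /= => /negP[].
by apply/forallP => k'; apply/implyP; exact: kmin.
Qed.

(** The chosen server comes from an activity of the class, and activities of one class are told
    apart by their servers, so exactly one term is 1. *)
Lemma sum_wwta (z : state s) (a : activity s) :
  \sum_(b : activity s | cls b == cls a) (wwta z (cls b) == Some (srv b))%:R = 1 :> R.
Proof.
have [b ba zb] := wwta_some z a; rewrite (bigD1 b) ?ba ?eqxx//= zb eqxx.
rewrite big1 ?addr0// => c /andP[/eqP ca cb]; rewrite ca zb.
case: eqP => // -[bc]; case/eqP: cb.
by apply: activity_inj; rewrite ?ca ?ba.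
Qed.

Lemma server_busy_or_idle (P : state s -> activity s -> R) z k :
  nonidling_policy P ->
  (server_jobs z k == 0%N)%:R + \sum_(a : activity s | srv a == k) P z a = 1.
Proof.
move=> [_ P0 P1]; have [jobs0|] := posnP (server_jobs z k); last first.
  by move=> jobs_gt0; rewrite P1// add0r.
rewrite big1 ?addr0// => a ak; apply: P0.
by move: jobs0; rewrite /server_jobs => /eqP; rewrite sum_nat_eq0 => /forall_inP/(_ a ak)/eqP.
Qed.

End routing.

(** * Flow balance of activities and the idleness identity *)

Theorem lemma5p2 (R : realType) (s : pss R)
    (v : 'I_(nclass s) -> R) (u : 'I_(nserver s) -> R)
    (P : state s -> activity s -> R) :
  relaxed_heavy_traffic s ->
  relaxed_resource_pooling s ->
  dual_optimal v u ->
  nonidling_policy P ->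
  forall (r : R) (p : R -> state s -> state s -> R)
    (pi : state s -> \bar R)
    (d : measure_display) (Omega : measurableType d)
    (Pr : probability Omega R) (Z : Omega -> state s),
  0 < r -> r < 1 ->
  transition_function p ->
  has_generator p (generator (arrival_rate r) P) ->
  stationary_distribution p pi ->
  has_law Pr Z pi ->
  (\sum_k (u k)%:E * Pr [set w | server_jobs (Z w) k = 0%N]
   + \sum_k \sum_(a : activity s | srv a == k)
       (reduced_cost v u a)%:E * 'E_Pr[fun w => P (Z w) a] = r%:E)%E
  /\
  (forall a : activity s,
     (arrival_rate r (cls a))%:E
       * Pr [set w | wwta (Z w) (cls a) = Some (srv a)]
     = (mu a)%:E * 'E_Pr[fun w => P (Z w) a])%E.
Proof.
move=> [x [xopt _]] _ vuopt polP r p pi d Omega Pr Z r0 r1 pP pG piP ZP.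
have [lv1 u1] := dual_optimal_value xopt vuopt.
have lam0 (i : 'I_(nclass s)) : 0 <= arrival_rate r i.
  by rewrite mulr_ge0 ?subr_ge0// ltW// lambda_gt0.
pose E := law_mean Pr Z.
have Pb a z : `|P z a| <= 1.
  by have [/(_ z a)/andP[? ?] _ _] := polP; rewrite ger0_norm.
have EP a : ('E_Pr[fun w => P (Z w) a] = (E (fun z => P z a))%:E)%E.
  by rewrite expectation.unlock (law_meanE ZP (Pb a)).
have indb (b : pred (state s)) z : `|(b z)%:R : R| <= 1.
  by case: (b z); rewrite ?normr1 ?normr0.
have EI (b : pred (state s)) : Pr [set w | b (Z w)] = (E (fun z => (b z)%:R))%:E.
  rewrite -(law_meanE ZP (indb b)).
  rewrite (eq_integral (fun w => (\1_[set w' | b (Z w')] w)%:E)); last first.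
    by move=> w _; rewrite indicE; congr ((nat_of_bool _)%:R%:E); apply/idP/idP; rewrite in_setE.
  rewrite integral_indic ?setIT//.
  exact: (measurable_law_preimage ZP [set z | b z]).
have EIdle k : Pr [set w | server_jobs (Z w) k = 0%N] =
    (E (fun z => (server_jobs z k == 0%N)%:R))%:E.
  by rewrite -EI; congr (Pr _); apply/seteqP; split => w /= /eqP.
have ERoute a : Pr [set w | wwta (Z w) (cls a) = Some (srv a)] =
    (E (fun z => (wwta z (cls a) == Some (srv a))%:R))%:E.
  by rewrite -EI; congr (Pr _); apply/seteqP; split => w /= /eqP.
have bal a : arrival_rate r (cls a) * E (fun z => (wwta z (cls a) == Some (srv a))%:R)
    = mu a * E (fun z => P z a).
  have := activity_balance lam0 polP pP pG piP ZP a.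
  rewrite (_ : (fun z => _) = fun z => arrival_rate r (cls a) *
    (wwta z (cls a) == Some (srv a))%:R + - mu a * P z a); last first.
    by apply/funext => z; rewrite mulNr.
  rewrite (law_meanD ZP (C := `|arrival_rate r (cls a)|) (D := `|- mu a|)).
  - rewrite (law_meanZ ZP _ (Pb a)) (law_meanZ ZP _ (indb _)).
    by rewrite mulNr => /eqP; rewrite subr_eq0 => /eqP.
  - move=> z; rewrite normrM -[leRHS]mulr1 ler_pM//.
    exact: (indb (fun z => wwta z (cls a) == Some (srv a))).
  - by move=> z; rewrite normrM -[leRHS]mulr1 ler_pM.
split; last by move=> a; rewrite ERoute EP -!EFinM bal.
have route1 i : \sum_(a : activity s | cls a == i)
    E (fun z => (wwta z (cls a) == Some (srv a))%:R) = 1.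
  (* The positive rate [lambda i] is a sum over the activities of class [i], so there is at least
     one. *)
  have [a ai] : exists a : activity s, cls a = i.
    have [[_ _ /(_ i) xl _] _] := xopt.
    apply: contrapT => /forallNP noa; have := lambda_gt0 i.
    by rewrite -xl big_pred0 ?ltxx// => a; apply/eqP/noa.
  rewrite -(law_mean_sum ZP _ _ (C := fun=> 1)); last first.
    by move=> b z; exact: (indb (fun z => wwta z (cls b) == Some (srv b))).
  by rewrite -[RHS](law_mean_cst Pr Z 1) -ai; congr law_mean; apply/funext => z; rewrite sum_wwta.
have idle1 k : E (fun z => (server_jobs z k == 0%N)%:R) +
    \sum_(a : activity s | srv a == k) E (fun z => P z a) = 1.
  rewrite -(law_mean_sum ZP _ _ (C := fun=> 1)); last by move=> a z; exact: Pb.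
  rewrite -(law_meanD ZP (C := 1) (D := \sum_(a : activity s | srv a == k) 1)).
  - rewrite -[RHS](law_mean_cst Pr Z 1); congr law_mean; apply/funext => z.
    exact: server_busy_or_idle.
  - by move=> z; exact: (indb (fun z => server_jobs z k == 0%N)).
  - by move=> z; rewrite (le_trans (ler_norm_sum _ _ _))// ler_sum.
under eq_bigr do rewrite EIdle -EFinM.
under [X in (_ + X)%E]eq_bigr do under eq_bigr do rewrite EP -EFinM.
rewrite sumEFin; under [X in (_ + X)%E]eq_bigr do rewrite sumEFin.
rewrite sumEFin -EFinD; congr EFin.
(* By [idle1], the idle term and the [u] part of the reduced costs add up to [u k], leaving only the
   [v] part. *)
rewrite -big_split /= (eq_bigr (fun k => u k - \sum_(a : activity s | srv a == k)
  v (cls a) * (mu a * E (fun z => P z a)))); last first.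
  move=> k _; have -> : u k - \sum_(a : activity s | srv a == k)
      v (cls a) * (mu a * E (fun z => P z a)) = u k * (E (fun z => (server_jobs z k == 0%N)%:R)
      + \sum_(a : activity s | srv a == k) E (fun z => P z a))
      - \sum_(a : activity s | srv a == k) v (cls a) * (mu a * E (fun z => P z a)).
    by rewrite idle1 mulr1.
  rewrite mulrDr -addrA; congr (_ + _).
  rewrite mulr_sumr -sumrB; apply: eq_bigr => a /eqP <-.
  by rewrite /reduced_cost; ring.
rewrite sumrB u1 sum_activity.
(* Flow balance turns service into routed arrivals. Regrouped by class, the routing probabilities
   sum to 1, so the [v] part is [1 - r] times the dual value 1, and [1 - (1 - r) = r]. *)
rewrite (eq_bigr (fun a => v (cls a) * (arrival_rate r (cls a) *
  E (fun z => (wwta z (cls a) == Some (srv a))%:R)))); last by move=> a _; rewrite bal.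
rewrite -(sum_activity (@cls R s)) (eq_bigr (fun i => (1 - r) * (lambda i * v i))).
  by rewrite -mulr_sumr lv1; ring.
move=> i _; rewrite (eq_bigr (fun a => v i * arrival_rate r i *
  E (fun z => (wwta z (cls a) == Some (srv a))%:R))); last first.
  by move=> a /eqP <-; rewrite mulrA.
by rewrite -mulr_sumr route1 /arrival_rate; ring.
Qed.
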